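(* Consider cumulative subtraction with two possible actions, $S=\{s_2,s_1\}$, with $s_1>s_2>s_1/2$, and let $\alpha=s_1-s_2$. Then the largest heap size for which Positive can play the smaller action $s_2$ until the game ends, and obtain the optimal play outcome, is $$s_1\left\lfloor\frac{s_2}{\alpha}\right\rfloor+s_2\left\lfloor\frac{s_1}{\alpha}\right\rfloor+\alpha-1 .$$
   Context: Cumulative subtraction (CS): $S$ is a finite set of positive integers with $|S|\ge 2$. Starting from a heap of $x\in\mathbb{Z}_{\ge 0}$ pebbles and score $0$, two players, Positive (who starts) and Negative, alternate in removing $s\in S$ pebbles, with $s$ at most the current heap size; Positive's move adds $s$ to the score and Negative's move subtracts $s$. The game ends when the heap is smaller than $\min S$. Positive maximizes and Negative minimizes the terminal score. The optimal play outcome from heap size $x$ is $o(x)$, where $o$ is defined recursively on $\mathbb{Z}_{\ge 0}$ by $o(x)=0$ if $x<\min S$ and $o(x)=\max\{s-o(x-s)\mid s\in S,\ s\le x\}$ if $x\ge\min S$. *)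

(* Defs.v *)
From mathcomp Require Import all_boot all_order all_algebra.
Set Implicit Arguments.
Unset Strict Implicit.
Unset Printing Implicit Defensive.
Import Order.TTheory GRing.Theory Num.Theory.
Local Open Scope ring_scope.

(* Both operations below return 0 on the empty sequence; the default is itself
   an item otherwise, so they are the minimum and the maximum of the sequence.
   Action sets are given as sequences, of which only membership matters. *)
Definition min_action (S : seq nat) : nat := \big[minn/head 0%N S]_(s <- S) s.

Definition max_int (v : seq int) : int := \big[Num.max/head 0 v]_(w <- v) w.

(* The recursion on the heap size is bounded by n, which is harmless when
   every action is positive and x <= n: see outcome_small and outcome_large
   for the defining equations. *)
Fixpoint outcome_rec (S : seq nat) (n x : nat) : int :=
  if n is n'.+1 then
    if (x < min_action S)%N then 0
    else max_int [seq s%:Z - outcome_rec S n' (x - s) | s <- S & (s <= x)%N]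
  else 0.

Definition outcome (S : seq nat) (x : nat) : int := outcome_rec S x x.

Lemma outcome_small (S : seq nat) (x : nat) :
  (x < min_action S)%N -> outcome S x = 0.
Proof. by rewrite /outcome; case: x => //= x ->. Qed.

Lemma outcome_recE (S : seq nat) (n m x : nat) :
  all (ltn 0) S -> (x <= n)%N -> (x <= m)%N ->
  outcome_rec S n x = outcome_rec S m x.
Proof.
move=> S0.
have zero k : outcome_rec S k 0 = 0.
  case: k => //= k; case: ifP => // _.
  have -> : [seq s <- S | (s <= 0)%N] = [::].
    apply/eqP; rewrite -(negbK (_ == _)) -has_filter.
    by apply/hasP => -[s /(allP S0) /= + /(leq_trans _) h]; move/h.
  by rewrite /max_int /= big_nil.
elim: n m x => [|n IHn] [|m] x.
- by [].
- by rewrite leqn0 => /eqP-> _; rewrite !zero.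
- by move=> _; rewrite leqn0 => /eqP->; rewrite !zero.
move=> xn xm /=; case: ifP => // _; congr max_int.
apply/eq_in_map => s; rewrite mem_filter => /andP[sx /(allP S0) /= s0].
congr (_ - _); apply: IHn; rewrite leq_subLR;
  by [apply: leq_trans xn _; rewrite -add1n leq_add2r
     |apply: leq_trans xm _; rewrite -add1n leq_add2r].
Qed.

Lemma outcome_large (S : seq nat) (x : nat) :
  all (ltn 0) S -> (0 < x)%N -> (min_action S <= x)%N ->
  outcome S x = max_int [seq s%:Z - outcome S (x - s) | s <- S & (s <= x)%N].
Proof.
move=> S0; rewrite {1}/outcome; case: x => // x _ Sx /=; rewrite ltnNge Sx /=.
congr max_int; apply/eq_in_map => s.
rewrite mem_filter => /andP[sx /(allP S0) /= s0].
congr (_ - _); apply: outcome_recE => //.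
by rewrite leq_subLR -add1n leq_add2r.
Qed.

(* A play is the sequence p of actions taken from an initial heap x: Positive
   makes the moves of even index, Negative those of odd index. *)
Definition heap_at (x : nat) (p : seq nat) (i : nat) : nat :=
  (x - sumn (take i p))%N.

Definition complete_play (S : seq nat) (x : nat) (p : seq nat) : Prop :=
  (forall i, (i < size p)%N ->
     nth 0%N p i \in S /\ (nth 0%N p i <= heap_at x p i)%N) /\
  (heap_at x p (size p) < min_action S)%N.

Definition score (p : seq nat) : int :=
  \sum_(i < size p) (-1) ^+ i * (nth 0%N p i)%:Z.

(* The game is symmetric, so from a heap y the score that Negative, when to
   move, still expects to be added is - outcome S y; hence the same criterion
   applies to both players. *)
Definition optimal_action (S : seq nat) (y s : nat) : Prop :=
  [/\ s \in S, (s <= y)%N & s%:Z - outcome S (y - s) = outcome S y].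

(* Positive takes a at each of her turns, and Negative always replies with an
   action that is optimal at the current heap. *)
Definition constant_play (S : seq nat) (a x : nat) (p : seq nat) : Prop :=
  [/\ complete_play S x p,
      forall i, (i < size p)%N -> ~~ odd i -> nth 0%N p i = a &
      forall i, (i < size p)%N -> odd i ->
        optimal_action S (heap_at x p i) (nth 0%N p i)].

(* Whichever optimal actions Negative chooses when there are several, Positive
   ends with the optimal play outcome. *)
Definition can_play_optimally (S : seq nat) (a x : nat) : Prop :=
  (exists p, constant_play S a x p) /\
  (forall p, constant_play S a x p -> score p = outcome S x).

Definition is_largest (P : nat -> Prop) (m : nat) : Prop :=
  P m /\ forall x, P x -> (x <= m)%N.

(* Main.v *)
Require Import Defs.
From mathcomp Require Import all_boot all_order all_algebra.
From mathcomp Require Import zify.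

(* Write s = s2, a = s1 - s2, p = s1 + s2 and K = floor(s/a).  Since a play in
   which Positive always takes s never scores more than the outcome o, it
   attains o exactly when s is optimal at each of her heaps.
   Below (K + 1) p + s the outcome is explicit: with fl u the largest multiple
   of a not exceeding u,
     o(kp + u) = max(ka - fl u, 0)               for u < s,
     o(kp + s + u) = min(s - ka + fl u, s + a)   for u < s + a.
   On the last period |o(y) - o(y + a)| <= a, a property that propagates upwards
   and makes the larger action optimal at every later heap.
   On the blocks kp + s + [0, a) with k <= K, Positive can take s, after which
   Negative must take s + a (or the game ends), leading to the previous block.
   From any other heap x >= s, either s is not optimal, or Negative has an
   optimal reply s + a leading to x - p; iterating, one never enters a block,
   because s is not optimal on (K + 1) p + s + [0, a). *)

Set Implicit Arguments.
Unset Strict Implicit.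
Unset Printing Implicit Defensive.
Import Order.TTheory GRing.Theory Num.Theory.

(** * Extrema of sequences *)

Lemma min_action_le (S : seq nat) (s : nat) : s \in S -> min_action S <= s.
Proof.
rewrite /min_action; move: (head 0 S) => d.
elim: S => //= t S IHS; rewrite inE big_cons geq_min => /orP[/eqP->|/IHS->].
  by rewrite leqnn.
by rewrite orbT.
Qed.

Lemma max_int_ge (v : seq int) (w : int) : w \in v -> (w <= max_int v)%R.
Proof.
rewrite /max_int; move: (head 0%R v) => d.
elim: v => //= t v IHv; rewrite inE big_cons le_max => /orP[/eqP->|/IHv->].
  by rewrite lexx.
by rewrite orbT.
Qed.

Lemma max_int_mem (v : seq int) : v != [::] -> max_int v \in v.
Proof.
(* The fold starts from the head of the sequence, so a default value can only repeat an existing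
   item. *)
have mem (d : int) (u : seq int) : \big[Num.max/d]_(w <- u) w \in d :: u.
  elim: u => [|w u IHu]; first by rewrite big_nil inE.
  rewrite big_cons maxEle !inE; case: ifP => _; last by rewrite eqxx orbT.
  by move: IHu; rewrite inE => /orP[->|->] //; rewrite !orbT.
case: v => // d v _; have := mem d (d :: v).
by rewrite /max_int /= !inE orbA orbb.
Qed.

(** * Plays repeating the least action, for arbitrary action sets *)

Section Plays.

Variables (S : seq nat) (a : nat).
Hypotheses (S_gt0 : all (ltn 0) S) (aS : a \in S) (a_min : a = min_action S).

Lemma a_gt0 : 0 < a. Proof. exact: (allP S_gt0 a aS). Qed.

Lemma outcome_ge (x s : nat) : s \in S -> s <= x ->
  (s%:Z - outcome S (x - s) <= outcome S x)%R.
Proof.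
move=> sS sx; rewrite (@outcome_large S x) //.
- by apply: max_int_ge; apply/mapP; exists s; rewrite // mem_filter sx.
- by apply: leq_trans sx; exact: (allP S_gt0 s sS).
- exact: leq_trans (min_action_le sS) sx.
Qed.

Lemma optimal_action_exists (x : nat) : a <= x -> exists s, optimal_action S x s.
Proof.
move=> ax; have x0 : 0 < x := leq_trans a_gt0 ax.
have : [seq (s%:Z - outcome S (x - s))%R | s <- S & s <= x] != [::].
  have: a \in [seq s <- S | s <= x] by rewrite mem_filter ax.
  by case: [seq s <- S | s <= x].
move/max_int_mem/mapP => -[s]; rewrite mem_filter => /andP[sx sS] E.
by exists s; split=> //; rewrite -E -outcome_large // -a_min.
Qed.

Lemma heap_at_cons (x s i : nat) (p : seq nat) :
  heap_at x (s :: p) i.+1 = heap_at (x - s) p i.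
Proof. by rewrite /heap_at /= subnDA. Qed.

Lemma heap_at0 (x : nat) (p : seq nat) : heap_at x p 0 = x.
Proof. by rewrite /heap_at take0 subn0. Qed.

Lemma complete_play_nil (x : nat) : complete_play S x [::] <-> x < a.
Proof. by rewrite /complete_play heap_at0 a_min; split=> [[]|]. Qed.

Lemma complete_play_cons (x s : nat) (p : seq nat) :
  complete_play S x (s :: p) <->
  [/\ s \in S, s <= x & complete_play S (x - s) p].
Proof.
split=> [[H L]|[sS sx [H L]]].
  have := H 0 isT; rewrite heap_at0 => -[sS sx].
  split=> //; split=> [i ip|]; last by rewrite -(heap_at_cons x s).
  by have := H i.+1 ip; rewrite heap_at_cons.
split=> [[|i] ip|]; rewrite /= ?heap_at_cons ?heap_at0 //; exact: H i ip.
Qed.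

Lemma constant_play_nil (x : nat) : constant_play S a x [::] <-> x < a.
Proof.
split=> [[/complete_play_nil]|xa] //.
by split=> //; apply/complete_play_nil.
Qed.

Lemma constant_play_one (x s : nat) :
  constant_play S a x [:: s] <-> [/\ s = a, a <= x & x - a < a].
Proof.
split=> [[/complete_play_cons[sS sx /complete_play_nil L] H _]|[-> ax L]].
  by have /= E := H 0 isT isT; subst s.
split=> [|[]//|[]//].
by apply/complete_play_cons; split=> //; apply/complete_play_nil.
Qed.

(** Removing a whole round keeps the parity of the remaining indices, so plays can be treated by
    induction on rounds. *)
Lemma constant_play_cons2 (x s t : nat) (p : seq nat) :
  constant_play S a x (s :: t :: p) <->
  [/\ s = a, a <= x, optimal_action S (x - a) t &
      constant_play S a (x - a - t) p].
Proof.
split.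
  case=> /complete_play_cons[sS sx /complete_play_cons[tS tx L]] H1 H2.
  have /= E := H1 0 isT isT; subst s; have := H2 1 isT isT.
  rewrite heap_at_cons heap_at0 => /= Ht; split=> //; split=> // i ip io.
    by apply: (H1 i.+2) => //=; rewrite negbK.
  by have := H2 i.+2 ip; rewrite /= negbK !heap_at_cons; apply.
case=> -> ax Ht [L H1 H2]; have [tS tx _] := Ht; split.
- by apply/complete_play_cons; split=> //; apply/complete_play_cons; split.
- by case=> [|[|i]] //=; rewrite negbK; exact: H1.
- by case=> [|[|i]] //=; rewrite ?negbK !heap_at_cons ?heap_at0 //; exact: H2.
Qed.

Lemma score_cons2 (s t : nat) (p : seq nat) :
  score (s :: t :: p) = (s%:Z - t%:Z + score p)%R.
Proof.
rewrite /score /= !big_ord_recl /= expr0 mul1r expr1 mulN1r addrA.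
by congr (_ + _)%R; apply: eq_bigr => i _; rewrite !exprS !mulN1r opprK.
Qed.

Lemma score_one (s : nat) : score [:: s] = Posz s.
Proof. by rewrite /score big_ord1 expr0 mul1r. Qed.

Lemma score_nil : score [::] = 0%R.
Proof. by rewrite /score big_ord0. Qed.

Lemma constant_play_exists (x : nat) : exists p, constant_play S a x p.
Proof.
elim/ltn_ind: x => x IHx.
have [xa|ax] := ltnP x a; first by exists [::]; apply/constant_play_nil.
have [xa|aax] := ltnP (x - a) a; first by exists [:: a]; apply/constant_play_one.
have [t Ht] := optimal_action_exists aax.
have [|p Hp] := IHx (x - a - t); first by have := a_gt0; lia.
by exists [:: a, t & p]; apply/constant_play_cons2.
Qed.

(** In each round Positive's move gains at most what an optimal one would, and Negative's optimal
    reply concedes nothing. *)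
Lemma score_le_outcome (x : nat) (p : seq nat) :
  constant_play S a x p -> (score p <= outcome S x)%R.
Proof.
elim/ltn_ind: x p => x IHx [|s [|t p]].
- move/constant_play_nil => xa.
  by rewrite score_nil outcome_small // -a_min.
- case/constant_play_one => -> ax xa; rewrite score_one.
  by have := outcome_ge aS ax; rewrite outcome_small -?a_min // subr0.
- case/constant_play_cons2 => -> ax [tS tx E] Hp.
  have lt : x - a - t < x by have := a_gt0; lia.
  have := IHx _ lt p Hp; have := outcome_ge aS ax.
  rewrite score_cons2 -E; lia.
Qed.

(** This replaces plays by a recursion on heaps. If a play attains the outcome, the two inequalities
    [outcome_ge] at [x] and [score_le_outcome] after the round must both be equalities. Existence of
    plays keeps the quantification over them from being vacuous. *)
Lemma can_play_optimally_step (x : nat) : a <= x ->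
  can_play_optimally S a x <->
  optimal_action S x a /\
  (a <= x - a -> forall t, optimal_action S (x - a) t ->
     can_play_optimally S a (x - a - t)).
Proof.
move=> ax; split=> [[_ H]|[[_ _ E] H]].
- have step t q : optimal_action S (x - a) t ->
      constant_play S a (x - a - t) q ->
      optimal_action S x a /\ score q = outcome S (x - a - t).
    move=> Ht Hq; have /H : constant_play S a x [:: a, t & q].
      exact/constant_play_cons2.
    rewrite score_cons2; case: Ht => _ _ Et.
    have := score_le_outcome Hq; have := outcome_ge aS ax.
    by move=> ? ? ?; split; [split=> //; lia | lia].
  split=> [|aax t Ht]; last first.
    by split=> [|q Hq]; [exact: constant_play_exists|case: (step t q)].
  have [xa|aax] := ltnP (x - a) a.
    have /H : constant_play S a x [:: a] by apply/constant_play_one.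
    rewrite score_one => E; split=> //.
    by rewrite [outcome S (x - a)]outcome_small ?subr0 -?a_min.
  have [t Ht] := optimal_action_exists aax.
  have [q Hq] := constant_play_exists (x - a - t).
  by case: (step t q).
- split; first exact: constant_play_exists.
  case=> [|s [|t p]].
  + by move/constant_play_nil; lia.
  + case/constant_play_one => -> _ xa; rewrite score_one -E.
    by rewrite [outcome S (x - a)]outcome_small ?subr0 // -a_min.
  + case/constant_play_cons2 => -> _ Ht Hp; have [tS tx Et] := Ht.
    have aax : a <= x - a by apply: leq_trans tx; rewrite a_min min_action_le.
    rewrite score_cons2; have [_ ->] // := H aax t Ht; lia.
Qed.

End Plays.

(** * Explicit outcomes for two actions on the first periods *)

Section TwoActions.

Variables s a : nat.
Hypotheses (a_pos : 0 < a) (a_lt : a < s).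

Let o (x : nat) : int := outcome [:: s; s + a] x.
Let p := s + (s + a).
Let K := s %/ a.
Let fl (u : nat) := u %/ a * a.

Lemma actions_gt0 : all (ltn 0) [:: s; s + a].
Proof. by rewrite /=; lia. Qed.

Lemma min_actionE : s = min_action [:: s; s + a].
Proof. rewrite /min_action /= !big_cons big_nil; lia. Qed.

Lemma o_small x : x < s -> o x = 0%R.
Proof. by move=> xs; rewrite /o outcome_small // -min_actionE. Qed.

Lemma o_ge x t : t \in [:: s; s + a] -> t <= x -> (t%:Z - o (x - t) <= o x)%R.
Proof. exact: (outcome_ge actions_gt0). Qed.

Lemma o_cases x : s <= x -> o x = (s%:Z - o (x - s))%R \/
  s + a <= x /\ o x = ((s + a)%:Z - o (x - (s + a)))%R.
Proof.
move=> sx; have [t] :=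
  optimal_action_exists actions_gt0 (mem_head _ _) min_actionE sx.
by rewrite /o => -[]; rewrite !inE => /orP[]/eqP-> ? <-; [left|right].
Qed.

Lemma o_maxP x : s + a <= x ->
  [/\ (s%:Z - o (x - s) <= o x)%R, ((s + a)%:Z - o (x - (s + a)) <= o x)%R &
      o x = (s%:Z - o (x - s))%R \/ o x = ((s + a)%:Z - o (x - (s + a)))%R].
Proof.
move=> x1; split; try by apply: o_ge; rewrite ?inE ?eqxx ?orbT //; lia.
by have [|->|[_ ->]] := @o_cases x; [lia|left|right].
Qed.

Lemma flP u : fl u <= u < fl u + a.
Proof. by rewrite /fl; have := divn_eq u a; have := ltn_pmod u a_pos; lia. Qed.

Lemma flD u : fl (u + a) = fl u + a.
Proof. by rewrite /fl divnDr // divnn a_pos mulnDl mul1n. Qed.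

Lemma fl_small u : u < a -> fl u = 0.
Proof. by rewrite /fl => /divn_small ->. Qed.

Lemma fl_ge k u : k * a <= u -> k * a <= fl u.
Proof. by move=> ku; rewrite /fl leq_mul2r -leq_divRL // in ku *; rewrite ku orbT. Qed.

Lemma K_le k : k <= K -> k * a <= s.
Proof. by rewrite /K leq_divRL. Qed.

(** Truncated subtraction encodes the maximum with 0 here; in [high_part] it is exact as soon as
    [k * a <= s]. *)
Definition low_part k :=
  forall u, u < s -> o (k * p + u) = Posz (k * a - fl u).
Definition high_part k :=
  forall u, u < s + a -> o (k * p + s + u) = Posz (minn (s + fl u - k * a) (s + a)).

Lemma low_part0 : low_part 0.
Proof. by move=> u us; rewrite !mul0n add0n sub0n o_small. Qed.

(** Both options fall in the preceding high part, at offsets [u + a] and [u]; the larger action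
    wins. *)
Lemma low_partS k : k * a <= s -> high_part k -> low_part k.+1.
Proof.
move=> ka H u us.
have [|] := @o_maxP (k.+1 * p + u); first by rewrite /p; lia.
have -> : k.+1 * p + u - s = k * p + s + (u + a) by rewrite /p; lia.
have -> : k.+1 * p + u - (s + a) = k * p + s + u by rewrite /p; lia.
rewrite !H ?flD; lia.
Qed.

(** Here the smaller action wins: the larger one either does not fit ([k = 0]) or reaches a heap
    worth [s + a] and so yields only 0. *)
Lemma high_part_start k : k <= K -> low_part k ->
  (forall l, k = l.+1 -> high_part l) ->
  forall u, u < a -> o (k * p + s + u) = Posz (s - k * a).
Proof.
move=> kK L H u ua; have ka := K_le kK.
case: k => [|k] in kK L H ka *.
  rewrite mul0n add0n subn0; have [|->|[]] := @o_cases (s + u); try lia.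
  by rewrite addKn o_small; lia.
have [|] := @o_maxP (k.+1 * p + s + u); first by rewrite /p; lia.
have -> : k.+1 * p + s + u - s = k.+1 * p + u by lia.
have -> : k.+1 * p + s + u - (s + a) = k * p + s + (s + u) by rewrite /p; lia.
have : k.+1 * a <= fl (s + u) by apply: fl_ge; lia.
rewrite L ?(H k) ?(fl_small ua); lia.
Qed.

(** Past the first [a] offsets the larger action reaches the low part and gives the formula. For
    [u >= s] the smaller one lands back in the initial segment of the same high part, hence the
    separate lemma above. *)
Lemma high_partP k : k <= K -> low_part k ->
  (forall l, k = l.+1 -> high_part l) -> high_part k.
Proof.
move=> kK L H u us; have ka := K_le kK; have E0 := high_part_start kK L H.
have [ua|au] := ltnP u a; first by rewrite E0 ?fl_small; lia.
have [|] := @o_maxP (k * p + s + u); first by rewrite /p; lia.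
have -> : k * p + s + u - (s + a) = k * p + (u - a) by lia.
have -> : k * p + s + u - s = k * p + u by lia.
have := flD (u - a); rewrite subnK // => flu; have := flP (u - a).
rewrite (L (u - a)); last by lia.
have [us'|su] := ltnP u s; first by rewrite L; lia.
have -> : k * p + u = k * p + s + (u - s) by lia.
have : k * a <= fl u by apply: fl_ge; lia.
rewrite E0; lia.
Qed.

(** The low parts reach one period further, since [low_partS] needs the bound only at the previous
    index. *)
Lemma parts k : (k <= K.+1 -> low_part k) /\ (k <= K -> high_part k).
Proof.
elim: k => [|k [_ IHh]].
  by split=> [_|kK]; [exact: low_part0|apply: high_partP low_part0 _].
have low : k.+1 <= K.+1 -> low_part k.+1.
  by move=> kK; apply: low_partS (IHh kK); exact: K_le.
split=> // kK; apply: high_partP => //; first exact/low/leqW.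
by move=> _ [<-]; apply: IHh; exact: ltnW.
Qed.

Lemma o_low k u : k <= K.+1 -> u < s -> o (k * p + u) = Posz (k * a - fl u).
Proof. by move=> kK; case: (parts k) => /(_ kK) L _; exact: L. Qed.

Lemma o_high k u : k <= K -> u < s + a ->
  o (k * p + s + u) = Posz (minn (s + fl u - k * a) (s + a)).
Proof. by move=> kK; case: (parts k) => _ /(_ kK) L; exact: L. Qed.

(** * Bounded variation and optimality of the larger action *)

Lemma K_gt : s < K.+1 * a.
Proof. by rewrite /K ltn_ceil. Qed.

Lemma o_lipschitz y : K * p + s <= y ->
  (- a%:Z <= o y - o (y + a) <= a%:Z)%R.
Proof.
elim/ltn_ind: y => y IHy wy.
have [yp|py] := ltnP y (K.+1 * p).
  have -> : y = K * p + s + (y - (K * p + s)) by lia.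
  move: (y - _) (subnKC wy) => u uy; have us : u < s + a by move: yp; rewrite /p; lia.
  rewrite o_high //; have Ka := K_le (leqnn K); have fu := flP u.
  have [ua|au] := ltnP (u + a) (s + a).
    by rewrite -addnA o_high // flD; lia.
  (* The shift crosses into the next period, but both outcomes lie between [s] and [s + a]. *)
  have -> : K * p + s + u + a = K.+1 * p + (u - s) by rewrite /p; lia.
  have := K_gt; have : K * a <= fl u by apply: fl_ge; lia.
  by rewrite o_low ?(@fl_small (u - s)); lia.
have y1 : s + a + (K * p + s) <= y by move: py; rewrite /p; lia.
(* The heaps [y] and [y + a] share the successor [y - s]. The induction hypotheses make the larger
   action optimal at both, so the new difference is, up to sign, the one at [y - (s + a)]. *)
have := IHy (y - (s + a)); have := IHy (y - s).
have -> : y - (s + a) + a = y - s by lia.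
have [|] := @o_maxP y; first by lia.
have [|] := @o_maxP (y + a); first by lia.
have -> : y + a - (s + a) = y - s by lia.
have -> : y + a - s = y - s + a by lia.
lia.
Qed.

Lemma o_block k j : k <= K -> j < a -> o (k * p + s + j) = Posz (s - k * a).
Proof. move=> kK ja; rewrite o_high ?(fl_small ja); lia. Qed.

Lemma larger_action_optimal y : s + a <= y ->
  o y = ((s + a)%:Z - o (y - (s + a)))%R \/
  exists k j, [/\ k <= K, j < a, k * a < s & y = k * p + s + j].
Proof.
move=> y1; have [py|yp] := leqP (K.+1 * p) y.
  left; have [|] := @o_maxP y; first by lia.
  have := @o_lipschitz (y - (s + a)).
  have -> : y - (s + a) + a = y - s by lia.
  move: py; rewrite /p; lia.
have p_gt0 : 0 < p by rewrite /p; lia.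
have kK : y %/ p <= K by rewrite -ltnS ltn_divLR.
have := divn_eq y p; have := ltn_pmod y p_gt0.
move: (y %/ p) (y %% p) kK => k r kK rp Ey; have ka := K_le kK.
have [rs|sr] := ltnP r s.
  left; case: k => [|k] in kK Ey ka *; first by lia.
  have -> : y - (s + a) = k * p + s + r by move: Ey; rewrite /p; lia.
  have fr := flP r.
  rewrite Ey o_low ?o_high; lia.
have {}Ey : y = k * p + s + (r - s) by lia.
have {rp sr} : r - s < s + a by move: rp; rewrite /p; lia.
move: (r - s) Ey => u Ey us.
have [ua|au] := ltnP u a; last first.
  left; have -> : y - (s + a) = k * p + (u - a) by lia.
  have := flD (u - a); rewrite subnK // => flu; have := flP (u - a).
  rewrite Ey o_low ?o_high; lia.
have [kas|ska] := ltnP (k * a) s; first by right; exists k, u.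
(* Now [k * a = s]: the block has outcome 0, which the larger action also attains because it leads
   to a heap worth [s + a]. *)
left; case: k => [|k] in kK Ey ka ska *; first by lia.
have -> : y - (s + a) = k * p + s + (s + u) by move: Ey; rewrite /p; lia.
have : k.+1 * a <= fl (s + u) by apply: fl_ge; lia.
rewrite Ey o_block ?o_high; lia.
Qed.

(** * Heaps where the smaller action can be kept *)

Let can_play := can_play_optimally [:: s; s + a] s.

Lemma can_play_step x : s <= x -> can_play x <->
  optimal_action [:: s; s + a] x s /\
  (s <= x - s -> forall t, optimal_action [:: s; s + a] (x - s) t ->
     can_play (x - s - t)).
Proof.
exact: (can_play_optimally_step actions_gt0 (mem_head _ _) min_actionE).
Qed.

Lemma can_play_block k j : k <= K -> j < a -> can_play (k * p + s + j).
Proof.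
move=> kK ja; elim: k kK => [|k IHk] kK; have ka := K_le kK.
  apply/can_play_step; first by lia.
  split; last by lia.
  split; rewrite ?mem_head //; first by lia.
  have /= := o_block kK ja; rewrite /o => ->.
  have := @o_low 0 j isT; rewrite /o => E.
  have -> : 0 * p + s + j - s = 0 * p + j by lia.
  by rewrite E; lia.
apply/can_play_step; first by lia.
have -> : k.+1 * p + s + j - s = k.+1 * p + j by lia.
have Ey : o (k.+1 * p + j) = Posz (k.+1 * a).
  by rewrite o_low ?(fl_small ja); lia.
split=> [|_ t [+ ty]].
  split; rewrite ?mem_head //; first by lia.
  have -> : k.+1 * p + s + j - s = k.+1 * p + j by lia.
  rewrite -/(o _) -/(o _) Ey o_block; lia.
rewrite !inE -/(o _) -/(o _) Ey => /orP[]/eqP->.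
  (* Replying [s] would be worth [k * a - a] to Negative, short of the outcome [k.+1 * a]. *)
  have -> : k.+1 * p + j - s = k * p + s + (j + a) by rewrite /p; lia.
  rewrite o_high ?flD ?(fl_small ja); lia.
have -> : k.+1 * p + j - (s + a) = k * p + s + j by rewrite /p; lia.
by move=> _; apply: IHk; exact: ltnW.
Qed.

Lemma can_play_is_block x : s <= x -> can_play x ->
  exists k j, [/\ k <= K, j < a & x = k * p + s + j].
Proof.
elim/ltn_ind: x => x IHx sx /(can_play_step sx)[[_ _]].
rewrite -/(o _) -/(o _) => Ex next.
have [xsa|x1] := ltnP x (s + a); first by exists 0, (x - s); split=> //; lia.
have [_ x_ge _] := o_maxP x1.
have [xp|px] := ltnP (x - s) (s + a).
  (* The larger action leaves a finished game and earns [s + a]; the smaller one cannot match it, as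
     [o (x - s)] is nonnegative. *)
  move: x_ge Ex; rewrite [o (x - (s + a))]o_small; last by lia.
  have [xs|ss] := ltnP (x - s) s; first by rewrite [o (x - s)]o_small; lia.
  have := @o_high 0 (x - s - s) isT; rewrite mul0n add0n subnKC //; lia.
have [E|[k [j [kK ja kas y_eq]]]] := larger_action_optimal px; last first.
  have : k * a <= fl (s + j) by apply: fl_ge; lia.
  have := @o_high k (s + j) kK.
  have -> : k * p + s + (s + j) = x by lia.
  move: Ex; rewrite y_eq o_block; lia.
have {next} : can_play (x - s - (s + a)).
  by apply: next; [lia|split; rewrite ?inE ?eqxx ?orbT //].
have [x2|x2] := ltnP (x - s - (s + a)) s.
  (* Here [o (x - s) = s + a], so the smaller action would earn [- a] although [o x >= 0]. *)
  have := @o_low 1 (x - p); have := @o_high 0 (x - p + a) isT.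
  rewrite !mul1n subnKC ?mul0n ?add0n ?flD; last by rewrite /p; lia.
  have -> : s + (x - p + a) = x - s by rewrite /p; lia.
  move: Ex; rewrite /p; lia.
case/(IHx _ _ x2) => [|k [j [kK ja Exp]]]; first by lia.
have {}Exp : x = k.+1 * p + s + j by rewrite /p in Exp *; lia.
have [kK'|] := ltnP k K; first by exists k.+1, j.
move=> Kk; have {Kk}Ek : k = K by lia.
(* One block too far: the smaller action earns [s - K.+1 * a < 0], the larger one at least 0. *)
subst k; have := K_gt; have := @o_high K (s + j) kK.
have -> : K * p + s + (s + j) = x - (s + a) by move: Exp; rewrite /p; lia.
have := @o_low K.+1 j (leqnn _); rewrite (fl_small ja).
have -> : K.+1 * p + j = x - s by lia.
lia.
Qed.

End TwoActions.

Theorem corollary14 (s1 s2 : nat) (h21 : s2 < s1) (h12 : s1 < 2 * s2) :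
  let alpha := s1 - s2 in
  is_largest (can_play_optimally [:: s2; s1] s2)
    (s1 * (s2 %/ alpha) + s2 * (s1 %/ alpha) + alpha - 1).
Proof.
move=> alpha; have a0 : 0 < alpha by rewrite /alpha; lia.
have as2 : alpha < s2 by rewrite /alpha; lia.
have Es1 : s1 = s2 + alpha by rewrite /alpha; lia.
move: alpha a0 as2 Es1 => a a0 as2 Es1; rewrite {}Es1 {h21 h12 s1}.
(* With this quotient the claimed bound becomes the top heap of block [K], at offset [a - 1]. *)
have -> : (s2 + a) %/ a = (s2 %/ a).+1 by rewrite divnDr // divnn a0 addn1.
set K := s2 %/ a; split.
  have -> : (s2 + a) * K + s2 * K.+1 + a - 1
            = K * (s2 + (s2 + a)) + s2 + (a - 1) by lia.
  by apply: can_play_block => //; lia.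
move=> x; have [xs|sx] := ltnP x s2; first by lia.
case/(can_play_is_block a0 as2 sx) => k [j [kK ja ->]].
have : k * (s2 + (s2 + a)) <= K * (s2 + (s2 + a)) by rewrite leq_mul2r kK orbT.
lia.
Qed.
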